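(* Let $n\ge 6$ and $s\ge 1$ be integers, and let $\mathcal{E}^s_n$ be the class of all simple bipartite graphs on $n$ vertices with edge connectivity exactly $s$. Let $G$ be a graph in $\mathcal{E}^s_n$ attaining the maximum value of $M_1$ over $\mathcal{E}^s_n$ (respectively, the maximum value of $M_2$ over $\mathcal{E}^s_n$). Then: (i) if $n$ is odd, $G\cong O_s\vee_1\big(K_1\cup K_{\frac{n-1}{2},\frac{n-1-2s}{2}}\big)$; (ii) if $n$ is even and $s=\frac{n}{2}$, then $G\cong K_{\frac n2,\frac n2}$; if $n$ is even and $s\le \frac n2-1$, then $G\cong O_s\vee_1\big(K_1\cup K_{\frac{n}{2},\frac{n-2-2s}{2}}\big)$.
   Context: All graphs are finite, simple and undirected. For a graph $G$, the first Zagreb index is $M_1(G)=\sum_{u\in V(G)} d(u)^2$ and the second Zagreb index is $M_2(G)=\sum_{uv\in E(G)} d(u)d(v)$, where $d(u)$ is the degree of $u$. The edge connectivity $\kappa'(G)$ is the largest integer $s$ such that $|V(G)|>1$ and $G-E'$ is connected for every edge set $E'\subseteq E(G)$ with $|E'|<s$ (and $\kappa'(G)=0$ if $G$ is disconnected). $K_{p,q}$ denotes the complete bipartite graph with parts of sizes $p$ and $q$; by convention $K_{p,0}$ ($p\ge1$) is the empty graph $pK_1$. For positive integers $n\ge r\ge s$, the graph $O_s\vee_1(K_1\cup K_{n-r-1,r-s})$ is defined as follows: take an independent set $C$ of $s$ vertices (the empty graph $O_s$), a single vertex $v$, and a complete bipartite graph $K_{n-r-1,r-s}$ with parts $A$ of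 size $n-r-1$ and $B$ of size $r-s$; add all edges between $C$ and $v$ and all edges between $C$ and $A$. This graph has $n$ vertices. *)

(* Defs.v *)
From mathcomp Require Import all_boot.

Set Implicit Arguments.
Unset Strict Implicit.
Unset Printing Implicit Defensive.

Record sgraph := SGraph {
  vertex :> finType;
  adj : rel vertex;
  adj_sym : symmetric adj;
  adj_irrefl : irreflexive adj
}.

Definition deg (G : sgraph) (u : G) : nat := #|[set v | adj u v]|.

Definition edges (G : sgraph) : {set {set G}} :=
  [set [set p.1; p.2] | p : G * G & adj p.1 p.2].

Definition zagreb1 (G : sgraph) : nat := \sum_(u : G) deg u ^ 2.

(* Each edge e = {u, v} has two distinct elements, so the product over e is
   d(u) d(v). *)
Definition zagreb2 (G : sgraph) : nat :=
  \sum_(e in edges G) \prod_(u in e) deg u.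

Definition isomorphic (G H : sgraph) : Prop :=
  exists2 f : G -> H, bijective f & forall x y, adj (f x) (f y) = adj x y.

Definition bipartite (G : sgraph) : Prop :=
  exists A : {set G}, forall x y, adj x y -> (x \in A) != (y \in A).

Definition connected (G : sgraph) : bool :=
  [forall x : G, forall y : G, connect (@adj G) x y].

Section DeleteEdges.
Variables (G : sgraph) (E : {set {set G}}).

Definition del_rel : rel G := fun x y => adj x y && ([set x; y] \notin E).

Lemma del_rel_sym : symmetric del_rel.
Proof. by move=> x y; rewrite /del_rel adj_sym setUC. Qed.

Lemma del_rel_irrefl : irreflexive del_rel.
Proof. by move=> x; rewrite /del_rel adj_irrefl. Qed.

Definition del_edges : sgraph := SGraph del_rel_sym del_rel_irrefl.

End DeleteEdges.

Definition edge_connected (G : sgraph) (k : nat) : bool :=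
  (1 < #|G|) && [forall E : {set {set G}},
    (E \subset edges G) && (#|E| < k) ==> connected (del_edges E)].

(* Deleting all edges of a graph with more than one vertex disconnects it, so
   edge_connected G k forces k <= #|edges G|, and the maximum below ranges over
   every relevant k (see edge_connectivityP).  The value is 0 if G is
   disconnected or has at most one vertex. *)
Definition edge_connectivity (G : sgraph) : nat :=
  \max_(k < #|edges G|.+1 | edge_connected G k) k.

Lemma edge_connected_le (G : sgraph) k :
  edge_connected G k -> k <= #|edges G|.
Proof.
case/andP=> /card_gt1P[x [y [_ _ neq_xy]]] /forallP/(_ (edges G)).
rewrite subxx /= => conn; rewrite leqNgt; apply/negP=> lt_k.
have /forallP/(_ x)/forallP/(_ y)/connectP[[|z p] /=] := implyP conn lt_k.
  by move=> _ eq_xy; rewrite eq_xy eqxx in neq_xy.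
case/andP=> /andP[adj_xz /imsetP[]]; exists (x, z) => //.
by rewrite inE.
Qed.

Lemma edge_connectivityP (G : sgraph) s : 1 < #|G| ->
  edge_connectivity G = s <->
  edge_connected G s /\ (forall k, edge_connected G k -> k <= s).
Proof.
move=> gt1.
have ec0 : edge_connected G 0.
  by rewrite /edge_connected gt1; apply/forallP=> E; rewrite andbF.
have ub k : edge_connected G k -> k <= edge_connectivity G.
  move=> ek; have lt_k : k < #|edges G|.+1 by rewrite ltnS edge_connected_le.
  exact: (@leq_bigmax_cond _ _ (fun i : 'I__ => i : nat) (Ordinal lt_k) ek).
have att : edge_connected G (edge_connectivity G).
  rewrite /edge_connectivity.
  have : 0 < #|[pred k : 'I_#|edges G|.+1 | edge_connected G k]|.
    by apply/card_gt0P; exists ord0.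
  by case/(eq_bigmax_cond (fun i : 'I__ => i : nat)) => i + ->.
split=> [<- //|[es max_s]].
by apply/eqP; rewrite eqn_leq max_s ?ub.
Qed.

(* Since 'I_0 is empty, Kbip p 0 is the edgeless graph on p vertices. *)
Section CompleteBipartite.
Variables p q : nat.

Definition Kbip_rel : rel ('I_p + 'I_q) := fun x y =>
  match x, y with
  | inl _, inr _ | inr _, inl _ => true
  | _, _ => false
  end.

Lemma Kbip_sym : symmetric Kbip_rel.
Proof. by case=> [x|x] [y|y]. Qed.

Lemma Kbip_irrefl : irreflexive Kbip_rel.
Proof. by case. Qed.

Definition Kbip : sgraph := SGraph Kbip_sym Kbip_irrefl.

End CompleteBipartite.

(* O_s \/_1 (K_1 U K_{p,q}): the s vertices of the independent set are joined
   to the vertex of K_1 and to the p vertices of the first part of K_{p,q}. *)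
Section Join1.
Variables s p q : nat.

Definition join1_rel : rel ('I_s + (unit + Kbip p q)) := fun x y =>
  match x, y with
  | inl _, inr (inl _) | inr (inl _), inl _ => true
  | inl _, inr (inr (inl _)) | inr (inr (inl _)), inl _ => true
  | inr (inr a), inr (inr b) => adj a b
  | _, _ => false
  end.

Lemma join1_sym : symmetric join1_rel.
Proof. by case=> [x|[x|[x|x]]] [y|[y|[y|y]]]. Qed.

Lemma join1_irrefl : irreflexive join1_rel.
Proof. by case=> [x|[x|[x|x]]]. Qed.

Definition join1 : sgraph := SGraph join1_sym join1_irrefl.

End Join1.

Definition bip_class (n s : nat) (G : sgraph) : Prop :=
  [/\ bipartite G, #|G| = n & edge_connectivity G = s].

Definition maximizer (F : sgraph -> nat) (C : sgraph -> Prop) (G : sgraph) :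
    Prop :=
  C G /\ forall H : sgraph, C H -> F H <= F G.

(* Main.v *)
(* Suppose some vertex v has degree s and let X be its colour class.  Then G is
   a subgraph of the graph in which v is joined to N(v) and every other vertex
   of X to the whole opposite class; this graph is O_s \/_1 (K_1 U K_{p,t-s})
   with p = |X| - 1 and t = n - |X|, and both indices increase strictly when
   edges are added.  Comparing the values over p + t = n - 1 with t >= s gives
   p = n/2 (rounded down).
   Otherwise all degrees exceed s, and a cut with at most s edges splits the
   two colour classes into four parts a, b, c, d, each larger than s, because
   few vertices on either side have a neighbour across the cut.  Hence there
   are at most ab + cd + s edges, each contributing at most |X| + |Y| = n,
   respectively |X||Y|, which is less than the index of the extremal graph. *)

Require Import Defs.
From mathcomp Require Import all_boot zify.

Set Implicit Arguments.
Unset Strict Implicit.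
Unset Printing Implicit Defensive.

(** * Both Zagreb indices as sums over ordered adjacent pairs *)

Lemma degE (G : sgraph) (u : G) : deg u = \sum_v adj u v.
Proof.
by rewrite /deg -sum1_card big_mkcond; apply: eq_bigr => v _; rewrite inE;
  case: adj.
Qed.

Lemma deg_gt0 (G : sgraph) (u v : G) : adj u v -> 0 < deg u.
Proof. by move=> uv; apply/card_gt0P; exists v; rewrite inE. Qed.

(** Common form of the two indices: addition gives twice $M_1$ and multiplication twice $M_2$, so
    the extremal argument can be run once for a general [phi]. *)
Definition arc_sum (phi : nat -> nat -> nat) (G : sgraph) : nat :=
  \sum_(u : G) \sum_(v | adj u v) phi (deg u) (deg v).

Lemma arc_sum_addn (G : sgraph) : arc_sum addn G = 2 * zagreb1 G.
Proof.
have sumE : \sum_(u : G) \sum_(v | adj u v) deg u = zagreb1 G.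
  apply: eq_bigr => u _; rewrite sum_nat_const expnS expn1; congr (_ * _).
  by rewrite /deg; apply: eq_card => v; rewrite inE.
rewrite /arc_sum; under eq_bigr do rewrite big_split /=.
rewrite big_split /= sumE mul2n -addnn; congr (_ + _).
rewrite (exchange_big_dep xpredT) //= -sumE.
by apply: eq_bigr => u _; apply: eq_bigl => v; rewrite adj_sym.
Qed.

(** Grouping the ordered pairs by their underlying edge, each edge receives exactly the two pairs
    [(x, y)] and [(y, x)]. *)
Lemma arc_sum_muln (G : sgraph) : arc_sum muln G = 2 * zagreb2 G.
Proof.
rewrite /arc_sum pair_big_dep /zagreb2 big_distrr /=.
rewrite (partition_big (fun p : G * G => [set p.1; p.2]) (mem (edges G))) /=;
  last first.
  by move=> p ap; apply/imsetP; exists p => //; rewrite inE.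
apply: eq_bigr => e /imsetP[[x y]]; rewrite inE /= => xy ->.
have nxy : x != y by apply: contraTneq xy => ->; rewrite adj_irrefl.
rewrite big_setU1 ?inE //= big_set1.
rewrite (bigD1 (x, y)) /=; last by rewrite xy eqxx.
rewrite (bigD1 (y, x)) /=; last by rewrite adj_sym xy setUC eqxx xpair_eqE
  eq_sym (negbTE nxy).
rewrite big1 ?addn0 ?mul2n -?addnn 1?[deg y * _]mulnC //.
case=> a b /=; rewrite !xpair_eqE -!andbA => /and4P[ab /eqP eqs h1 h2].
have: a \in [set x; y] by rewrite -eqs !inE eqxx.
have: b \in [set x; y] by rewrite -eqs !inE eqxx orbT.
rewrite !inE => /orP[]/eqP eb /orP[]/eqP ea; subst.
- by rewrite adj_irrefl in ab.
- by rewrite !eqxx in h2.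
- by rewrite !eqxx in h1.
- by rewrite adj_irrefl in ab.
Qed.

(** Monotonicity keeps old terms from decreasing when edges are added; positivity makes each new arc
    count strictly. *)
Definition admissible (phi : nat -> nat -> nat) : Prop :=
  (forall a b c d, a <= c -> b <= d -> phi a b <= phi c d) /\
  (forall a b, 0 < a -> 0 < b -> 0 < phi a b).

(** * Monotonicity of arc sums under adding edges *)

Section SameVertices.
Variables (T : finType) (e f : rel T).
Variables (es : symmetric e) (ei : irreflexive e).
Variables (fs : symmetric f) (fi : irreflexive f).
Hypothesis ef : subrel e f.
Let G := SGraph es ei.
Let H := SGraph fs fi.

Lemma deg_subrel (u : T) : @deg G u <= @deg H u.
Proof.
by apply: subset_leq_card; apply/subsetP=> v; rewrite !inE; apply: ef.
Qed.

Lemma arc_sum_subrel phi : admissible phi -> arc_sum phi G <= arc_sum phi H.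
Proof.
case=> mono _; apply: leq_sum => u _.
rewrite [leqRHS](bigID (e u)) /= [X in _ <= X + _](eq_bigl (e u)); last first.
  by move=> v /=; case: (boolP (e u v)) => [/ef -> //|_]; rewrite andbF.
apply: (leq_trans _ (leq_addr _ _)).
by apply: leq_sum => v _; apply: mono; apply: deg_subrel.
Qed.

(** A pair in [f] but not in [e] would contribute a positive term on top of terms that are all at
    least as large as before. *)
Lemma arc_sum_subrel_eq phi : admissible phi ->
  arc_sum phi H <= arc_sum phi G -> e =2 f.
Proof.
case=> mono pos le u v; apply/idP/idP; first exact: ef.
move=> fuv; apply: contraTT le => neuv; rewrite -ltnNge /arc_sum.
rewrite !pair_big_dep /=.
rewrite [ltnRHS](bigID (fun p => e p.1 p.2)) /= -addn1 leq_add //.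
  rewrite [X in _ <= X](eq_bigl (fun p => e p.1 p.2)); last first.
    by move=> p /=; case: (boolP (e _ _)) => [/ef -> //|_]; rewrite andbF.
  by apply: leq_sum => p _; apply: mono; apply: deg_subrel.
rewrite (bigD1 (u, v)) /= ?fuv ?neuv //.
apply: (leq_trans _ (leq_addr _ _)); apply: pos.
  by apply: (@deg_gt0 H _ v).
by apply: (@deg_gt0 H _ u); rewrite adj_sym.
Qed.

End SameVertices.

Lemma iso_arc_sum phi (G H : sgraph) : isomorphic G H ->
  arc_sum phi G = arc_sum phi H.
Proof.
case=> f fbij fadj.
have degf u : deg (f u) = deg u.
  rewrite !degE (reindex f) /=; last exact: onW_bij.
  by apply: eq_bigr => v _; rewrite fadj.
rewrite /arc_sum (reindex f) /=; last exact: onW_bij.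
apply: eq_bigr => u _; rewrite [RHS](reindex f) /=; last exact: onW_bij.
by apply: eq_big => [v|v _]; rewrite ?fadj ?degf.
Qed.

(** * Degrees and indices of the extremal graph *)

Lemma card_join1 s p q : #|join1 s p q| = s + p + q + 1.
Proof. by rewrite !card_sum card_unit !card_ord; lia. Qed.

Section DegJoin1.
Variables s p q : nat.

Lemma deg_join1 (u : join1 s p q) :
  deg u = match u with
          | inl _ => p.+1
          | inr (inl _) => s
          | inr (inr (inl _)) => s + q
          | inr (inr (inr _)) => p
          end.
Proof.
rewrite degE big_sumType /= big_sumType /= big_sumType /=.
by case: u => [i|[[]|[i|i]]] /=; rewrite !sum_nat_const !card_ord card_unit;
  lia.
Qed.

Lemma zagreb1_join1 :
  zagreb1 (join1 s p q) =
  s * (2 * p + 1) + s ^ 2 + (p + (s + q)) * (p * (s + q)).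
Proof.
rewrite /zagreb1; under eq_bigr do rewrite deg_join1.
rewrite big_sumType /= big_sumType /= big_sumType /=.
by rewrite !sum_nat_const !card_ord card_unit; nia.
Qed.

Lemma zagreb2_join1 :
  zagreb2 (join1 s p q) =
  s ^ 2 * p.+1 + s * (p * (s + q)) + (p * (s + q)) ^ 2.
Proof.
apply/eqP; rewrite -(eqn_pmul2l (isT : 0 < 2)) -arc_sum_muln /arc_sum.
under eq_bigr => u _ do under eq_bigr => v _ do rewrite !deg_join1.
under eq_bigr => u _ do rewrite big_sumType /= big_sumType /= big_sumType /=.
rewrite big_sumType /= big_sumType /= big_sumType /=.
rewrite !big_pred0_eq !sum_nat_const !card_ord card_unit.
by apply/eqP; nia.
Qed.

End DegJoin1.

(** * Edge connectivity: a sufficient condition, the degree bound and minimum cuts *)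

Lemma set2_injr (T : finType) (x a b : T) : [set x; a] = [set x; b] -> a = b.
Proof.
move=> e; have: a \in [set x; b] by rewrite -e !inE eqxx orbT.
have: b \in [set x; a] by rewrite e !inE eqxx orbT.
by rewrite !inE => /orP[]/eqP ? /orP[]/eqP ?; congruence.
Qed.

Lemma mem_edges (G : sgraph) (x y : G) : adj x y -> [set x; y] \in edges G.
Proof. by move=> xy; apply/imsetP; exists (x, y) => //; rewrite inE. Qed.

(** Two vertices of [Y] are joined by [s] edge-disjoint paths of length two, and a vertex outside
    has [s] edges into [Y]; fewer than [s] deletions leave one of each intact. *)
Lemma edge_connected_hub (G : sgraph) (s : nat) (Y : {set G}) :
  1 < #|G| ->
  {in Y &, forall y z, y != z ->
    s <= #|[set a | adj y a] :&: [set a | adj z a]|} ->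
  (forall x, x \notin Y -> s <= #|[set a | adj x a] :&: Y|) ->
  edge_connected G s.
Proof.
move=> gt1 hub att; rewrite /edge_connected gt1 /=.
apply/forallP=> E; apply/implyP=> /andP[_ ltE].
set R := connect (@adj (del_edges E)).
have Rs x y : R x y = R y x by exact/sym_connect_sym/adj_sym.
have hubR : {in Y &, forall y z, R y z}.
  move=> y z yY zY; have [->|nyz] := eqVneq y z; first exact: connect0.
  (* If every path from [y] through [a] to [z] were broken, [g] would choose a deleted edge on each;
     these choices are distinct, so at least [s] edges would be deleted. *)
  pose g a := if [set y; a] \in E then [set y; a] else [set z; a].
  have [a] : exists a, [&& adj y a, adj z a & g a \notin E].
    apply/existsP; apply: contraLR (hub y z yY zY nyz) => /existsPn noa.
    rewrite -ltnNge; apply: leq_ltn_trans ltE.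
    rewrite -(card_in_imset (f := g)); last first.
      move=> a b; rewrite !inE => /andP[ya za] /andP[yb zb]; rewrite /g.
      have abs c d : adj z c -> [set y; c] = [set z; d] -> c = d.
        move=> zc e; have: z \in [set y; c] by rewrite e !inE eqxx.
        rewrite !inE eq_sym (negbTE nyz) /= => /eqP zcE.
        by rewrite zcE adj_irrefl in zc.
      case: ifP => _; case: ifP => _; try exact: set2_injr; first exact: abs.
      by move/esym/(abs _ _ zb).
    apply: subset_leq_card; apply/subsetP=> _ /imsetP[a + ->].
    by rewrite !inE => /andP[ya za]; have := noa a; rewrite ya za /= negbK.
  rewrite /g; case: ifP => [yaE|yaE] /and3P[ya za ga];
    first by rewrite yaE in ga.
  apply: (@connect_trans _ _ a); apply: connect1;
    first by rewrite /= /del_rel ya yaE.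
  by rewrite /= /del_rel adj_sym za setUC ga.
have attR (x : G) : exists2 y, y \in Y & R x y.
  have [xY|xY] := boolP (x \in Y); first by exists x => //; apply: connect0.
  have [y] : exists y, [&& adj x y, y \in Y & [set x; y] \notin E].
    apply/existsP; apply: contraLR (att x xY) => /existsPn noy.
    rewrite -ltnNge; apply: leq_ltn_trans ltE.
    rewrite -(card_in_imset (f := fun y => [set x; y])); last first.
      by move=> a b _ _; apply: set2_injr.
    apply: subset_leq_card; apply/subsetP=> _ /imsetP[a + ->].
    by rewrite !inE => /andP[ya za]; have := noy a; rewrite ya za /= negbK.
  case/and3P=> xy yY nE; exists y => //; apply: connect1.
  by rewrite /= /del_rel xy nE.
apply/forallP=> x; apply/forallP=> z.
have [y yY xy] := attR x; have [w wY zw] := attR z.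
apply: (connect_trans xy); apply: (connect_trans (hubR _ _ yY wY)).
by rewrite -/R Rs.
Qed.

(** Deleting the edges at [u] isolates it from any other vertex. *)
Lemma edge_connected_deg (G : sgraph) (k : nat) (u : G) :
  edge_connected G k -> k <= deg u.
Proof.
case/andP=> gt1 /forallP/(_ [set [set u; v] | v in [set v | adj u v]]).
set E := [set _ | _ in _] => conn; rewrite leqNgt; apply/negP=> lt.
have subE : E \subset edges G.
  by apply/subsetP=> _ /imsetP[v + ->]; rewrite inE; apply: mem_edges.
have ltE : #|E| < k by apply: leq_ltn_trans lt; apply: leq_imset_card.
move: conn; rewrite subE ltE /= => /forallP/(_ u)/forallP conn.
have [w nuw] : exists w, w != u.
  by case/card_gt1P: gt1 => x [y [_ _ nxy]]; have [<-|] := eqVneq x u;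
    [exists y; rewrite eq_sym | exists x].
have /connectP[[|z p] /=] := conn w; first by move=> _ wu;
  rewrite wu eqxx in nuw.
case/andP=> /andP[uz /negP nE] _ _; apply: nE.
by apply/imsetP; exists z => //; rewrite inE.
Qed.

(** By maximality some [E] with at most [edge_connectivity G] edges disconnects [G]. Take for [S]
    the set still reachable from some [u]: every edge leaving it lies in [E]. *)
Lemma edge_connectivity_cut (G : sgraph) : 1 < #|G| ->
  exists S : {set G}, [/\ exists u, u \in S, exists w, w \notin S &
    \sum_(x in S) \sum_(y in ~: S) adj x y <= edge_connectivity G].
Proof.
move=> gt1; have [_ mx] := (edge_connectivityP (edge_connectivity G) gt1).1
  erefl.
have : ~~ edge_connected G (edge_connectivity G).+1.
  by apply/negP=> /mx; rewrite ltnn.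
rewrite /edge_connected gt1 /= => /forallPn[E].
rewrite negb_imply ltnS => /andP[/andP[_ leE] /forallPn[u /forallPn[w nuw]]].
exists [set z | connect (@adj (del_edges E)) u z]; split.
- by exists u; rewrite inE connect0.
- by exists w; rewrite inE.
set S := [set _ | _]; apply: leq_trans leE.
have inE' (x y : G) : x \in S -> y \in ~: S -> adj x y -> [set x; y] \in E.
  rewrite !inE => ux nuy xy; apply: contraNT nuy => nE;
    apply: (connect_trans ux).
  by apply: connect1; rewrite /= /del_rel xy.
rewrite pair_big /= -big_mkcondr /= sum1_card.
rewrite -(card_in_imset (f := fun p : G * G => [set p.1; p.2])).
  apply: subset_leq_card; apply/subsetP=> _ /imsetP[[x y] + ->].
  by rewrite /in_mem /= -andbA => /and3P[xS yS xy]; apply: inE'.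
move=> [x y] [z w']; rewrite /in_mem /= -!andbA.
move=> /and3P[xS yS xy] /and3P[zS wS zw] e.
have xz : x = z.
  have: x \in [set z; w'] by rewrite -e !inE eqxx.
  rewrite !inE => /orP[/eqP//|/eqP xw]; have: w' \in ~: S by [].
  have: x \in S by [].
  by rewrite in_setC -xw => ->.
by rewrite xz in e *; rewrite (set2_injr e).
Qed.

(** * Recognising the two target graphs up to isomorphism *)

Lemma isomorphic_inv (G H : sgraph) (g : H -> G) : injective g ->
  #|G| = #|H| -> (forall x y, adj (g x) (g y) = adj x y) -> isomorphic G H.
Proof.
move=> ginj cGH gadj.
have [f gK fK] : bijective g by apply: inj_card_bij; rewrite ?cGH.
by exists f => [|x y]; [exists g | rewrite -gadj !fK].
Qed.

Section FullRel.
Variables (T : finType) (X : {set T}) (v : T) (C : {set T}).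

(* The largest bipartite graph with colour class X in which v is joined to
   nothing outside C. *)
Definition full_rel : rel T := fun x y =>
  [&& (x \in X) != (y \in X), (x == v) ==> (y \in C) & (y == v) ==> (x \in C)].

Lemma full_sym : symmetric full_rel.
Proof.
by move=> x y; rewrite /full_rel eq_sym; congr (_ && _); apply: andbC.
Qed.

Lemma full_irrefl : irreflexive full_rel.
Proof. by move=> x; rewrite /full_rel eqxx. Qed.

Hypotheses (vX : v \in X) (CX : C \subset ~: X).

(** The four parts of the join are [C], the vertex [v], the rest of [X], and the opposite class
    without [C]. *)
Lemma isomorphic_full :
  isomorphic (SGraph full_sym full_irrefl)
             (join1 #|C| #|X :\ v| #|~: X :\: C|).
Proof.
pose g (z : join1 #|C| #|X :\ v| #|~: X :\: C|) : T :=
  match z with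
  | inl i => enum_val i
  | inr (inl _) => v
  | inr (inr (inl i)) => enum_val i
  | inr (inr (inr i)) => enum_val i
  end.
have NC z : z \in C -> (z \in X = false) * (z == v = false).
  move=> zC; have := subsetP CX z zC; rewrite inE => zX.
  by rewrite (negbTE zX); split=> //; apply: contraNF zX => /eqP->.
have XC z : z \in X -> z \in C = false.
  by move=> zX; apply/negP=> /NC; rewrite zX; case.
have gC (i : 'I_#|C|) : let z := enum_val i in
    (z \in X = false) * (z == v = false) * (z \in C).
  by have zC := enum_valP i; rewrite /= !NC.
have gA (i : 'I_#|X :\ v|) : let z := enum_val i in
    (z \in X) * (z == v = false) * (z \in C = false).
  by have := enum_valP i; rewrite !inE => /= /andP[/negbTE-> zX]; rewrite zX XC.
have gB (i : 'I_#|~: X :\: C|) : let z := enum_val i in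
    (z \in X = false) * (z == v = false) * (z \in C = false).
  have := enum_valP i; rewrite !inE => /= /andP[/negbTE-> zX].
  by rewrite (negbTE zX); do !split=> //; apply: contraNF zX => /eqP->.
apply: (@isomorphic_inv (SGraph full_sym full_irrefl) _ g).
(* Membership in [X], equality with [v] and membership in [C] together tell the four parts apart, so
   equal images come from the same summand. *)
- move=> x y e.
  have eX : (g x \in X) = (g y \in X) by rewrite e.
  have ev : (g x == v) = (g y == v) by rewrite e.
  have eC : (g x \in C) = (g y \in C) by rewrite e.
  move: e eX ev eC.
  case: x => [i|[[]|[i|i]]]; case: y => [j|[[]|[j|j]]] //=;
    rewrite ?gC ?gA ?gB ?eqxx //; try by move=> /enum_val_inj->.
- rewrite card_join1.
  have := cardsC X; have := cardsD1 v X; rewrite vX.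
  have := cardsID C (~: X); rewrite (setIidPr CX) /=; lia.
move=> x y; case: x => [i|[[]|[i|i]]]; case: y => [j|[[]|[j|j]]] //=;
  by rewrite /full_rel ?gC ?gA ?gB ?eqxx ?vX ?(XC v).
Qed.

End FullRel.

Lemma isomorphic_Kbip (G : sgraph) (X : {set G}) :
  (forall x y, adj x y = ((x \in X) != (y \in X))) ->
  isomorphic G (Kbip #|X| #|~: X|).
Proof.
move=> adjE.
pose g (z : Kbip #|X| #|~: X|) : G :=
  match z with inl i => enum_val i | inr i => enum_val i end.
have gl (i : 'I_#|X|) : enum_val i \in X by apply: enum_valP.
have gr (i : 'I_#|~: X|) : (enum_val i \in X) = false.
  by have := enum_valP i; rewrite inE => /negbTE.
apply: (@isomorphic_inv _ _ g).
- move=> x y e; have eX : (g x \in X) = (g y \in X) by rewrite e.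
  move: e eX; case: x => i; case: y => j //=; rewrite ?gl ?gr //;
    by move=> /enum_val_inj->.
- by rewrite card_sum !card_ord cardsC.
by move=> x y; rewrite adjE; case: x => i; case: y => j //=; rewrite ?gl ?gr.
Qed.

(** * The extremal graph belongs to the class *)

Lemma edge_connectivity_eq (G : sgraph) (s : nat) (u : G) : 1 < #|G| ->
  edge_connected G s -> deg u = s -> edge_connectivity G = s.
Proof.
move=> gt1 ec du; apply/(edge_connectivityP _ gt1); split=> // k ek.
by rewrite -du; apply: edge_connected_deg.
Qed.

(** The hub is the colour class opposite to the single vertex: its members share all [p >= s]
    vertices of the first part, and every vertex outside it sees the whole [s]-set. The single
    vertex has degree [s], which bounds the connectivity from above. *)
Lemma bip_class_join1 (s p q : nat) : 0 < s -> s <= p ->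
  bip_class (s + p + q + 1) s (join1 s p q).
Proof.
move=> s0 sp; have gt1 : 1 < #|join1 s p q| by rewrite card_join1; lia.
split.
- exists [set z : join1 s p q |
    match z with inl _ | inr (inr (inr _)) => true | _ => false end].
  by move=> [i|[[]|[i|i]]] [j|[[]|[j|j]]]; rewrite !inE.
- exact: card_join1.
- apply: (@edge_connectivity_eq (join1 s p q) s (inr (inl tt)) gt1);
    last by rewrite deg_join1.
  pose Y : {set join1 s p q} := [set z : join1 s p q |
    match z with inl _ | inr (inr (inr _)) => true | _ => false end].
  apply: (@edge_connected_hub _ _ Y gt1).
    pose A (i : 'I_p) : join1 s p q := inr (inr (inl i)).
    have Ainj : injective A by move=> i j [].
    move=> y z yY zY _; apply: leq_trans sp _.
    rewrite -[p in p <= _]card_ord -(card_imset _ Ainj).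
    apply: subset_leq_card; apply/subsetP=> _ /imsetP[i _ ->].
    move: yY zY; rewrite !inE.
    by case: y => [j|[[]|[j|j]]]; case: z => [k|[[]|[k|k]]].
  move=> x xY.
  pose C (i : 'I_s) : join1 s p q := inl i.
  have Cinj : injective C by move=> i j [].
  rewrite -[s in s <= _]card_ord -(card_imset _ Cinj).
  apply: subset_leq_card; apply/subsetP=> _ /imsetP[i _ ->].
  by move: xY; rewrite !inE; case: x => [j|[[]|[j|j]]].
Qed.

(** * Counting edges around a cut of a bipartite graph *)

Definition arcs (G : sgraph) (P Q : {set G}) : nat :=
  \sum_(x in P) \sum_(y in Q) adj x y.

Section Arcs.
Variable G : sgraph.
Implicit Types P Q R X S : {set G}.

Lemma arcsC P Q : arcs P Q = arcs Q P.
Proof.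
rewrite /arcs exchange_big /=.
by apply: eq_bigr => x _; apply: eq_bigr => y _; rewrite adj_sym.
Qed.

Lemma leq_arcs P Q : arcs P Q <= #|P| * #|Q|.
Proof.
rewrite -sum_nat_const; apply: leq_sum => x _.
by rewrite -sum1_card; apply: leq_sum => y _; case: adj.
Qed.

Lemma arcsID R P Q : arcs P Q = arcs (P :&: R) Q + arcs (P :\: R) Q.
Proof. exact: big_setID. Qed.

Lemma arcs_deg P : arcs P setT = \sum_(x in P) deg x.
Proof.
by apply: eq_bigr => x _; rewrite degE; apply: eq_bigl => y; rewrite inE.
Qed.

Lemma arcs_eq0 P Q : {in P & Q, forall x y, ~~ adj x y} -> arcs P Q = 0.
Proof.
by move=> h; apply: big1 => x xP; apply: big1 => y yQ;
  rewrite (negbTE (h _ _ _ _)).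
Qed.

Lemma leq_card_arcs P k : (forall x : G, k <= deg x) -> #|P| * k <= arcs P setT.
Proof. by move=> h; rewrite arcs_deg -sum_nat_const; apply: leq_sum. Qed.

End Arcs.

Section Cut.
Variables (G : sgraph) (X S : {set G}).
Hypothesis bip : forall x y : G, adj x y -> (x \in X) != (y \in X).

Lemma arcs_same (P Q : {set G}) b :
  {in P, forall x, (x \in X) = b} -> {in Q, forall x, (x \in X) = b} ->
  arcs P Q = 0.
Proof.
move=> hP hQ; apply: arcs_eq0 => x y xP yQ; apply/negP=> /bip.
by rewrite hP ?hQ ?eqxx.
Qed.

Let a := #|S :&: X|.
Let b := #|S :\: X|.
Let c := #|~: S :&: X|.
Let d := #|~: S :\: X|.

Lemma cut_count s :
  (exists u, u \in S) -> (exists w, w \notin S) -> arcs S (~: S) <= s ->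
  (forall x : G, s < deg x) ->
  [/\ a + c = #|X|, b + d = #|~: X|, [&& s < a, s < b, s < c & s < d] &
    \sum_(u : G) deg u <= 2 * (a * b + c * d + s)].
Proof.
move=> [u uS] [w wS] cut hdeg.
have inP (R : {set G}) : {in R :&: X, forall x, (x \in X) = true}.
  by move=> x; rewrite inE => /andP[].
have niP (R : {set G}) : {in R :\: X, forall x, (x \in X) = false}.
  by move=> x; rewrite inE => /andP[/negbTE].
(* By bipartiteness [f] and [g] count the edges inside the two sides of the cut, while [e1] and [e2]
   count the two kinds of crossing edges. *)
pose f := arcs (S :&: X) (S :\: X); pose g := arcs (~: S :&: X) (~: S :\: X).
pose e1 := arcs (S :&: X) (~: S :\: X); pose e2 := arcs (S :\: X) (~: S :&: X).
have split4 (P : {set G}) : arcs P setT = arcs P (S :&: X) + arcs P (S :\: X)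
    + (arcs P (~: S :&: X) + arcs P (~: S :\: X)).
  rewrite (arcsC P setT) (arcsID S) setTI setTD (arcsID X S) (arcsID X (~: S)).
  by rewrite !(arcsC _ P).
have dA : arcs (S :&: X) setT = f + e1.
  by rewrite split4 (arcs_same (inP S) (inP S)) (arcs_same (inP S) (inP _)).
have dB : arcs (S :\: X) setT = f + e2.
  by rewrite split4 (arcs_same (niP S) (niP S)) (arcs_same (niP S) (niP _))
    arcsC addn0 addn0.
have dC : arcs (~: S :&: X) setT = g + e2.
  rewrite split4 (arcs_same (inP _) (inP S)) (arcs_same (inP _) (inP _)).
  by rewrite [arcs _ (S :\: X)]arcsC !add0n addnC.
have dD : arcs (~: S :\: X) setT = g + e1.
  rewrite split4 (arcs_same (niP _) (niP S)) (arcs_same (niP _) (niP _)).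
  by rewrite ![arcs (~: S :\: X) _]arcsC !addn0 addnC.
have cutE : arcs S (~: S) = e1 + e2.
  rewrite (arcsID X) ![arcs _ (~: S)]arcsC !(arcsID X (~: S)).
  rewrite (arcs_same (inP _) (inP S)) (arcs_same (niP _) (niP S)).
  by rewrite add0n addn0 arcsC [X in _ + X]arcsC.
have fle : f <= a * b := leq_arcs _ _.
have gle : g <= c * d := leq_arcs _ _.
have tot : \sum_(u : G) deg u = 2 * (f + g + e1 + e2).
  transitivity (arcs [set: G] setT).
    by rewrite arcs_deg; apply: eq_bigl => x; rewrite inE.
  rewrite (arcsID S) setTI setTD (arcsID X S) (arcsID X (~: S)) dA dB dC dD;
    lia.
have hA : a * s.+1 <= f + e1 by rewrite -dA; apply: leq_card_arcs.
have hB : b * s.+1 <= f + e2 by rewrite -dB; apply: leq_card_arcs.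
have hC : c * s.+1 <= g + e2 by rewrite -dC; apply: leq_card_arcs.
have hD : d * s.+1 <= g + e1 by rewrite -dD; apply: leq_card_arcs.
have ab0 : 0 < a + b by rewrite cardsID; apply/card_gt0P; exists u.
have cd0 : 0 < c + d by rewrite cardsID; apply/card_gt0P; exists w; rewrite inE.
rewrite cutE in cut.
(* One side of the cut: [x] and [y] are the sizes of its quarters, [h] its inner edges, [i] and [j]
   the crossing edges leaving each quarter. *)
have key x y h i j : 0 < x + y -> h <= x * y -> i + j <= s ->
    x * s.+1 <= h + i -> y * s.+1 <= h + j -> s < x /\ s < y.
  move: cut => _ {hA hB hC hD} xy0 hxy ij hx hy.
  have [sx|xs] := ltnP s x; have [sy|ys] := ltnP s y => //; exfalso.
  (* If [y <= s], the degree bound on the first quarter gives [x <= i <= s], against [s < x]. *)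
  - have : x * y + x <= x * s.+1 by rewrite -mulnSr leq_mul2l ltnS ys orbT.
    lia.
  - have : x * y + y <= y * s.+1 by rewrite -mulSnr mulnC leq_mul2l ltnS xs
      orbT.
    lia.
  (* If both are at most [s], then both are positive, and [i >= x * (s + 1 - y) >= x + s - y], and
     symmetrically for [j]; summing gives [i + j >= 2 * s], which exceeds [s]. *)
  - have x1 : 0 < x.
      case: (posnP x) => // x0; move: hxy xy0; rewrite x0 mul0n add0n => hxy y0.
      have := leq_pmull s.+1 y0; lia.
    have y1 : 0 < y.
      case: (posnP y) => // y0; move: hxy; rewrite y0 muln0 => hxy.
      have := leq_pmull s.+1 x1; lia.
    case: x x1 xs hxy hx hy xy0 => // x _ xs hxy hx hy _.
    case: y y1 ys hxy hx hy => // y _ ys hxy hx hy.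
    have [p sp] : exists p, s = x + p.+1 by exists (s - x.+1); lia.
    have [q sq] : exists q, s = y + q.+1 by exists (s - y.+1); lia.
    have hx' : x.+1 * s.+1 = x.+1 * y.+1 + x.+1 * q.+1 by rewrite -mulnDr;
      congr (_ * _); lia.
    have hy' : y.+1 * s.+1 = x.+1 * y.+1 + y.+1 * p.+1.
      by rewrite [x.+1 * _]mulnC -mulnDr; congr (_ * _); lia.
    have : x + q.+1 <= x.+1 * q.+1 by rewrite mulSn; lia.
    have : y + p.+1 <= y.+1 * p.+1 by rewrite mulSn; lia.
    lia.
have [sa sb] := key _ _ _ _ _ ab0 fle cut hA hB.
have [sc sd] : s < c /\ s < d by apply: (key _ _ g e2 e1) => //; rewrite addnC.
split; last by rewrite tot; lia.
- by rewrite /a /c -[RHS](cardsID S) setDE !(setIC X).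
- by rewrite /b /d -[RHS](cardsID S) !setDE !(setIC (~: X)).
- by rewrite sa sb sc sd.
Qed.

End Cut.

(** * Numerical comparison of the candidate values *)

(* M_1 and M_2 of join1 s p (t - s), for s <= t. *)
Definition val1 (s p t : nat) := s * (2 * p + 1) + s ^ 2 + (p + t) * (p * t).
Definition val2 (s p t : nat) := s ^ 2 * p.+1 + s * (p * t) + (p * t) ^ 2.

Lemma prod_shift (p t h d : nat) : p + t = h + d + h -> d <= 1 ->
  p != h + d ->
  (p < h + d /\ p * t <= (h + d) * h) \/
  exists2 k, 0 < k & [/\ p = h + d + k, h = t + k &
    p * t + k * (k + d) = (h + d) * h].
Proof.
move=> sum d1; rewrite neq_ltn => /orP[lt|gt]; [left|right].
  split=> //; have [j [pj j0]] : exists j, h + d = p + j /\ 0 < j.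
    by exists (h + d - p); lia.
  have -> : t = h + j by lia.
  have : j * d <= j * j by rewrite leq_mul2l; lia.
  by rewrite pj; nia.
exists (p - (h + d)); first lia.
have [k pk] : exists k, p = h + d + k by exists (p - (h + d)); lia.
have ht : h = t + k by lia.
by rewrite pk addKn; split=> //; rewrite ht; nia.
Qed.

(** For small [p] the term linear in [p] loses. For large [p] it gains [2 * s * k], less than the
    loss [(h + d + h) * k * (k + d)], because [s <= t < h]. *)
Lemma val1_opt (s p t h d : nat) : 0 < s -> s <= t -> p + t = h + d + h ->
  d <= 1 -> val1 s (h + d) h <= val1 s p t -> p = h + d.
Proof.
move=> s0 st sum d1; apply: contraTeq => np; rewrite -ltnNge /val1 sum.
case: (prod_shift sum d1 np) => [[lt le]|[k k0 [pE hE eq]]].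
  have : (h + d + h) * (p * t) <= (h + d + h) * ((h + d) * h) by rewrite
    leq_mul2l le orbT.
  have : s * (2 * p + 1) < s * (2 * (h + d) + 1) by rewrite ltn_mul2l s0; lia.
  lia.
have -> : s * (2 * p + 1) = s * (2 * (h + d) + 1) + s * (2 * k).
  by rewrite -mulnDr pE; congr (_ * _); lia.
rewrite -eq mulnDr.
have : s * (2 * k) < (h + d + h) * (k * (k + d)).
  apply: (@leq_trans (h * (2 * k))); first by rewrite ltn_mul2r; lia.
  have -> : h * (2 * k) = (h + h) * (k * 1) by lia.
  by apply: leq_mul; [lia | apply: leq_mul; lia].
lia.
Qed.

(** For large [p] the gain is [s ^ 2 * k], while the square of the product drops by at least
    [P * k], and [s ^ 2 < h ^ 2 <= P]. *)
Lemma val2_opt (s p t h d : nat) : 0 < s -> s <= t -> p + t = h + d + h ->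
  d <= 1 -> val2 s (h + d) h <= val2 s p t -> p = h + d.
Proof.
move=> s0 st sum d1; apply: contraTeq => np; rewrite -ltnNge /val2.
case: (prod_shift sum d1 np) => [[lt le]|[k k0 [pE hE eq]]].
  have : s * (p * t) <= s * ((h + d) * h) by rewrite leq_mul2l le orbT.
  have : (p * t) ^ 2 <= ((h + d) * h) ^ 2 by rewrite leq_exp2r.
  have : s ^ 2 * p.+1 < s ^ 2 * (h + d).+1 by rewrite ltn_mul2l expn_gt0 s0;
    lia.
  lia.
rewrite pE in eq *; move: eq; set Q := _ * t; set P := (h + d) * h => eq.
have -> : s ^ 2 * (h + d + k).+1 = s ^ 2 * (h + d).+1 + s ^ 2 * k.
  by rewrite -mulnDr; congr (_ * _); lia.
have s2 : s ^ 2 * k < P * k.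
  rewrite ltn_mul2r k0 /= expnS expn1.
  by apply: (@leq_trans (h * h)); [apply: ltn_mul; lia | apply: leq_mul; lia].
have QP : Q + k <= P by rewrite -eq leq_add2l leq_pmulr ?addn_gt0 ?k0.
have : Q ^ 2 + P * k <= P ^ 2.
  apply: (@leq_trans (P * (Q + k)));
    last by rewrite expnS expn1 leq_mul2l QP orbT.
  by rewrite mulnDr expnS expn1 leq_add2r leq_mul2r; lia.
have : s * Q <= s * P by rewrite leq_mul2l; lia.
lia.
Qed.

(** AM-GM on [a * b] and on [c * d], where each of [a + b] and [c + d] is at least [2 * s + 2]. In
    use [k] is [n - 2]. *)
Lemma four_quarters (s a b c d k : nat) : 0 < s ->
  [&& s < a, s < b, s < c & s < d] -> a + b + c + d = k + 2 ->
  4 * (a * b + c * d + s) <= k ^ 2.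
Proof.
move=> s0 /and4P[sa sb sc sd] sum.
have [x xE] : exists x, a + b = 2 * s + 2 + x by exists (a + b - (2 * s + 2));
  lia.
have [y yE] : exists y, c + d = 2 * s + 2 + y by exists (c + d - (2 * s + 2));
  lia.
have [hab _] := nat_AGM2 a b; have [hcd _] := nat_AGM2 c d.
rewrite xE in hab; rewrite yE in hcd.
have -> : k = 4 * s + 2 + x + y by lia.
(* Writing [s] as [r.+1] makes all coefficients of the slack in the identity below nonnegative. *)
have [r rE] : exists r, s = r.+1 by exists s.-1; lia.
rewrite rE in hab hcd *.
have : (4 * r.+1 + 2 + x + y) ^ 2 =
    (2 * r.+1 + 2 + x) ^ 2 + (2 * r.+1 + 2 + y) ^ 2 + 4 * r.+1 +
    (8 * r ^ 2 + 12 * r + 4 * (r * x) + 4 * (r * y) + 4 * x + 4 * y + 2 * (x *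
      y)).
  by lia.
lia.
Qed.

(** The right side is [(k + 1) ^ 2 - e ^ 2]. *)
Lemma balanced_prod k h e : e <= 1 -> h + e + h = k + 1 ->
  k * (k + 2) <= 4 * ((h + e) * h).
Proof.
by case: e => [|[|//]] _ sum;
  [have -> : k = 2 * h - 1 by lia | have -> : k = 2 * h by lia]; nia.
Qed.

(** With [k = n - 2], the chain [4 * (k + 2) * m <= (k + 2) * k ^ 2 <= (k + 1) * k * (k + 2) <= 4 *
    (k + 1) * P] settles the main terms; the summand [s ^ 2] gives strictness. *)
Lemma val1_cut (s a b c d h e : nat) : 0 < s ->
  [&& s < a, s < b, s < c & s < d] -> e <= 1 -> a + b + c + d = (h + e + h).+1
    ->
  (a + c + (b + d)) * (a * b + c * d + s) < val1 s (h + e) h.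
Proof.
move=> s0 ss e1 sum.
have [k kE] : exists k, a + b + c + d = k + 2 by exists (a + b + c + d - 2);
  move/and4P: ss => [*]; lia.
have m4 := four_quarters s0 ss kE.
have he : h + e + h = k + 1 by lia.
have P4 := balanced_prod e1 he.
rewrite /val1 he (_ : a + c + (b + d) = k + 2); last lia.
set m := a * b + _ + s in m4 *; set P := (h + e) * h in P4 *.
have : 4 * ((k + 2) * m) <= 4 * ((k + 1) * P).
  rewrite mulnCA [4 * (_ * P)]mulnCA.
  apply: (@leq_trans ((k + 2) * k ^ 2)); first by rewrite leq_mul2l m4 orbT.
  apply: (@leq_trans ((k + 1) * (k * (k + 2))));
    last by rewrite leq_mul2l P4 orbT.
  have -> : (k + 1) * (k * (k + 2)) = (k + 2) * (k * (k + 1)) by lia.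
  by rewrite expnS expn1 !leq_mul // leq_addr.
have : 0 < s ^ 2 by rewrite expn_gt0 s0.
lia.
Qed.

(** Here [4 * K <= (k + 2) ^ 2] and [4 * m <= k ^ 2], so [16 * K * m <= (k * (k + 2)) ^ 2 <= (4 * P)
    ^ 2]; the term [s ^ 2 * (h + e).+1] gives strictness. *)
Lemma val2_cut (s a b c d h e : nat) : 0 < s ->
  [&& s < a, s < b, s < c & s < d] -> e <= 1 -> a + b + c + d = (h + e + h).+1
    ->
  (a + c) * (b + d) * (a * b + c * d + s) < val2 s (h + e) h.
Proof.
move=> s0 ss e1 sum.
have [k kE] : exists k, a + b + c + d = k + 2 by exists (a + b + c + d - 2);
  move/and4P: ss => [*]; lia.
have m4 := four_quarters s0 ss kE.
have he : h + e + h = k + 1 by lia.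
have P4 := balanced_prod e1 he.
have [K4 _] := nat_AGM2 (a + c) (b + d).
rewrite (_ : a + c + (b + d) = k + 2) in K4; last lia.
rewrite /val2; set m := a * b + _ + s in m4 *; set P := (h + e) * h in P4 *.
set K := (a + c) * (b + d) in K4 *.
have : (4 * K) * (4 * m) <= (4 * P) ^ 2.
  apply: (@leq_trans ((k + 2) ^ 2 * k ^ 2)); first exact: leq_mul.
  by rewrite -expnMn leq_exp2r // mulnC.
have : 0 < s ^ 2 * (h + e).+1 by rewrite muln_gt0 expn_gt0 s0.
have -> : 4 * K * (4 * m) = 16 * (K * m) by lia.
have -> : (4 * P) ^ 2 = 16 * P ^ 2 by rewrite expnMn.
lia.
Qed.

(** * The extremal argument for a general index *)

Lemma leq_deg_bipartite (G : sgraph) (X : {set G}) (u : G) :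
  (forall x y : G, adj x y -> (x \in X) != (y \in X)) ->
  deg u <= if u \in X then #|~: X| else #|X|.
Proof.
move=> bip; case: ifP => uX; apply: subset_leq_card; apply/subsetP=> w;
  by rewrite !inE => /bip; rewrite uX; case: (w \in X).
Qed.

Section Extremal.
Variables (F : sgraph -> nat) (phi : nat -> nat -> nat).
Variable val : nat -> nat -> nat -> nat.
Hypothesis phiP : admissible phi.
Hypothesis phiC : commutative phi.
Hypothesis arc_sumF : forall G, arc_sum phi G = 2 * F G.
Hypothesis F_join1 : forall s p q, F (join1 s p q) = val s p (s + q).
Hypothesis val_opt : forall s p t h e, 0 < s -> s <= t ->
  p + t = h + e + h -> e <= 1 -> val s (h + e) h <= val s p t -> p = h + e.
Hypothesis val_cut : forall s a b c d h e, 0 < s ->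
  [&& s < a, s < b, s < c & s < d] -> e <= 1 ->
  a + b + c + d = (h + e + h).+1 ->
  phi (a + c) (b + d) * (a * b + c * d + s) < val s (h + e) h.

Lemma extremal_min_deg (G : sgraph) (s h e : nat) :
  0 < s -> s <= h -> e <= 1 ->
  maximizer F (bip_class (h + e + h).+1 s) G ->
  exists v : G, deg v = s.
Proof.
move=> s0 sh e1 [[[X bip] cG conn] mx].
have gt1 : 1 < #|G| by rewrite cG; lia.
have [ec _] := (edge_connectivityP s gt1).1 conn.
have [/existsP[v /eqP]|] := boolP [exists v : G, deg v == s]; first by exists v.
move=> /existsPn nd; exfalso.
have dG (x : G) : s < deg x by rewrite ltn_neqAle eq_sym nd edge_connected_deg.
have [S [uS wS]] := edge_connectivity_cut gt1; rewrite conn => cut.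
have [aX bX ss sumd] := cut_count bip uS wS cut dG.
set a := #|S :&: X| in aX ss sumd; set b := #|S :\: X| in bX ss sumd.
set c := #|~: S :&: X| in aX ss sumd; set d := #|~: S :\: X| in bX ss sumd.
have abcd : a + b + c + d = (h + e + h).+1.
  by rewrite -cG -(cardsC X) -aX -bX; lia.
have := val_cut s0 ss e1 abcd; apply/negP; rewrite -leqNgt.
have : val s (h + e) h <= F G.
  rewrite -[h in val _ _ h](subnKC sh) -F_join1; apply: mx.
  have -> : (h + e + h).+1 = s + (h + e) + (h - s) + 1 by lia.
  by apply: bip_class_join1; lia.
move=> /leq_trans; apply.
rewrite -(leq_pmul2l (isT : 0 < 2)) -arc_sumF mulnCA.
(* The ends of an arc lie in opposite classes, so their degrees are at most [a + c] and [b + d] in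
   some order; hence each arc contributes at most [phi (a + c) (b + d)]. *)
apply: (@leq_trans (phi (a + c) (b + d) * \sum_(u : G) deg u));
  last by rewrite leq_mul2l sumd orbT.
rewrite big_distrr /=; apply: leq_sum => u _.
rewrite mulnC {2}/deg -sum_nat_const big_mkcond [leqRHS]big_mkcond /=.
apply: leq_sum => w _; rewrite inE; case: ifP => // uw.
have := leq_deg_bipartite u bip; have := leq_deg_bipartite w bip.
have [mono _] := phiP; have := bip _ _ uw; rewrite aX bX.
case: (u \in X); case: (w \in X) => // _ dw du; last exact: mono.
by rewrite phiC; apply: mono.
Qed.

Lemma extremal_join1 (G : sgraph) (s h e : nat) :
  0 < s -> s <= h -> e <= 1 ->
  maximizer F (bip_class (h + e + h).+1 s) G ->
  isomorphic G (join1 s (h + e) (h - s)).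
Proof.
move=> s0 sh e1; case: G => T a as_ ai; set G := SGraph as_ ai => mxG.
have [v dv] := extremal_min_deg s0 sh e1 mxG.
case: mxG => [[[A bipA] cG conn] mx].
pose X := if v \in A then A else ~: A.
have vX : v \in X by rewrite /X; case: ifP; rewrite ?inE => ->.
have bip (x y : G) : adj x y -> (x \in X) != (y \in X).
  by move/bipA; rewrite /X; case: ifP; rewrite ?inE // => _; case: (x \in A);
    case: (y \in A).
pose C := [set w | adj v w].
have CX : C \subset ~: X.
  by apply/subsetP=> w; rewrite !inE => /bip; rewrite vX; case: (w \in X).
have sub : subrel (@adj G) (full_rel X v C).
  move=> x y xy; rewrite /full_rel bip //=; apply/andP; split.
    by apply/implyP=> /eqP xv; rewrite inE -xv.
  by apply/implyP=> /eqP yv; rewrite inE -yv adj_sym.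
have iso := isomorphic_full vX CX.
have cC : #|C| = s by rewrite -dv.
have cB : s + #|~: X :\: C| = #|~: X|.
  by rewrite -cC -[RHS](cardsID C) (setIidPr CX).
have cA : #|X :\ v|.+1 = #|X| by rewrite (cardsD1 v X) vX.
rewrite cC in iso.
have sum : #|X :\ v| + #|~: X| = h + e + h.
  by apply: succn_inj; rewrite -cG -(cardsC X); lia.
set p := #|X :\ v| in cA iso sum; set q := #|_ :\: C| in cB iso.
(* The balanced join lies in the class, so the maximiser is at least as good; together with the full
   graph containing [G] this sandwiches [F G] between two values of [val]. *)
have FG : val s (h + e) h <= F G.
  rewrite -[h in val _ _ h](subnKC sh) -F_join1; apply: mx.
  have -> : (h + e + h).+1 = s + (h + e) + (h - s) + 1 by lia.
  by apply: bip_class_join1; lia.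
have Fiso : arc_sum phi (SGraph (full_sym X v C) (full_irrefl X v C)) = 2 * val
  s p (s + q).
  by rewrite (iso_arc_sum _ iso) arc_sumF F_join1.
have Fle := arc_sum_subrel as_ ai (full_sym X v C) (full_irrefl X v C) sub phiP.
rewrite Fiso arc_sumF leq_pmul2l // in Fle.
have pE : p = h + e.
  by apply: (@val_opt s p (s + q)) s0 (leq_addr _ _) _ e1 (leq_trans FG Fle);
    rewrite cB.
have qE : q = h - s by lia.
(* Once [p = h + e], the two ends of the sandwich agree, so no edge of the full graph is missing
   from [G]. *)
have aE : a =2 full_rel X v C.
  apply: (@arc_sum_subrel_eq T _ _ as_ ai (full_sym X v C) (full_irrefl X v C)
    sub phi phiP).
  rewrite Fiso arc_sumF leq_pmul2l // pE; apply: leq_trans FG.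
  by rewrite qE subnKC.
rewrite pE qE in iso; case: iso => f fbij fadj; exists f => // x y.
by rewrite fadj /= aE.
Qed.

End Extremal.

Lemma admissible_addn : admissible addn.
Proof.
by split=> [a b c d|a b a0 b0]; [apply: leq_add | rewrite addn_gt0 a0].
Qed.

Lemma admissible_muln : admissible muln.
Proof.
by split=> [a b c d|a b a0 b0]; [apply: leq_mul | rewrite muln_gt0 a0].
Qed.

Lemma zagreb_extremal (G : sgraph) (s h e : nat) :
  0 < s -> s <= h -> e <= 1 ->
  maximizer zagreb1 (bip_class (h + e + h).+1 s) G \/
  maximizer zagreb2 (bip_class (h + e + h).+1 s) G ->
  isomorphic G (join1 s (h + e) (h - s)).
Proof.
move=> s0 sh e1 [] mx.
  exact: (extremal_join1 admissible_addn addnC arc_sum_addn zagreb1_join1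
            val1_opt val1_cut s0 sh e1 mx).
exact: (extremal_join1 admissible_muln mulnC arc_sum_muln zagreb2_join1
          val2_opt val2_cut s0 sh e1 mx).
Qed.

(** * The complete bipartite case and the parity split *)

(** The ends of an edge lie in opposite classes and have degree at least [s], so each class has at
    least [s] vertices. If [n = 2 * s], both have exactly [s] and every neighbourhood fills the
    opposite class. *)
Lemma bip_class_balanced (G : sgraph) (n s : nat) : 1 < n -> bip_class n s G ->
  2 * s <= n /\ (n = 2 * s -> isomorphic G (Kbip s s)).
Proof.
move=> n1 [[X bip] cG conn].
have gt1 : 1 < #|G| by rewrite cG.
have [ec _] := (edge_connectivityP s gt1).1 conn.
have dG (u : G) : s <= deg u by apply: edge_connected_deg.
have le (u : G) := leq_trans (dG u) (leq_deg_bipartite u bip).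
have cX := cardsC X; rewrite cG in cX.
have [->|s0] := posnP s; first by split=> [|nE]; lia.
have [u _] : exists u : G, u \in G by apply/card_gt0P; rewrite cG; lia.
have [w uw] : exists w, adj u w.
  have : 0 < deg u by apply: leq_trans (dG u).
  by case/card_gt0P=> w; rewrite inE; exists w.
have [sX sY] : s <= #|X| /\ s <= #|~: X|.
  have := le u; have := le w; have := bip _ _ uw.
  by case: (u \in X); case: (w \in X).
split=> [|nE]; first lia.
have [XE YE] : #|X| = s /\ #|~: X| = s by lia.
rewrite -{1}XE -YE; apply: isomorphic_Kbip => x y.
have full (P : {set G}) z : #|P| = s -> [set w | adj z w] \subset P -> [set w |
  adj z w] = P.
  by move=> cP sub; apply/eqP; rewrite eqEcard sub cP; apply: dG.
apply/idP/idP; first exact: bip.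
have nb (z : G) : [set w | adj z w] = if z \in X then ~: X else X.
  apply: full; first by case: ifP.
  apply/subsetP=> t; rewrite inE => /bip.
  by case: ifP => _; rewrite ?inE; case: (t \in X).
have -> : adj x y = (y \in [set w | adj x w]) by rewrite inE.
by rewrite nb; case: ifP => _; rewrite ?inE; case: (y \in X).
Qed.

Theorem theorem2p7 (n s : nat) (hn : 6 <= n) (hs : 1 <= s) (G : sgraph)
    (hG : maximizer zagreb1 (bip_class n s) G \/
          maximizer zagreb2 (bip_class n s) G) :
  (odd n ->
     isomorphic G (join1 s ((n - 1) %/ 2) ((n - 1 - 2 * s) %/ 2))) /\
  (~~ odd n ->
     (s = n %/ 2 -> isomorphic G (Kbip (n %/ 2) (n %/ 2))) /\
     (s <= n %/ 2 - 1 ->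
        isomorphic G (join1 s (n %/ 2) ((n - 2 - 2 * s) %/ 2)))).
Proof.
have n1 : 1 < n by lia.
have [s2n eqn] : 2 * s <= n /\ (n = 2 * s -> isomorphic G (Kbip s s)).
  by apply: bip_class_balanced n1 _; case: hG => [[]|[]].
split=> [on|en].
  (* For odd [n] the split of [n - 1] is even: [e = 0], and [s <= h] follows from [2 * s <= n]. *)
  have nE : n = ((n - 1) %/ 2 + 0 + (n - 1) %/ 2).+1 by lia.
  rewrite [in bip_class n]nE in hG.
  have := zagreb_extremal hs _ _ hG; rewrite addn0.
  have -> : (n - 1 - 2 * s) %/ 2 = (n - 1) %/ 2 - s by lia.
  by apply=> //; lia.
split=> [sE|sle]; first by rewrite -sE; apply: eqn; lia.
(* For even [n], [h = n / 2 - 1] and [e = 1], so the larger factor [h + e] is [n / 2]. *)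
have nE : n = ((n %/ 2 - 1) + 1 + (n %/ 2 - 1)).+1 by lia.
rewrite [in bip_class n]nE in hG.
have := zagreb_extremal hs sle _ hG.
have -> : n %/ 2 - 1 + 1 = n %/ 2 by lia.
have -> : (n - 2 - 2 * s) %/ 2 = n %/ 2 - 1 - s by lia.
by apply.
Qed.
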